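(* Let $\alpha\in\mathbb{R}$, let $\mathcal{A}\neq0$ be a real antisymmetric $n\times n$ matrix and let $\mathbf{v}\in\mathbb{R}^n$ with $\mathcal{A}\mathbf{v}=0$. Then along any solution $(\mathbf{C}(s),\mathbf{T}(s))$ of the soliton flow the quantity \[ V(\mathbf{C},\mathbf{T})=e^{\frac{\alpha}{2}\|\mathbf{C}\|^2+\langle\mathbf{v},\mathbf{C}\rangle}\langle\mathbf{T},\mathcal{A}\mathbf{C}\rangle \] satisfies \[ \frac{dV}{ds}=e^{\frac{\alpha}{2}\|\mathbf{C}\|^2+\langle\mathbf{v},\mathbf{C}\rangle}\,\|\mathfrak{p}_{\mathbf{T}}(\mathcal{A}\mathbf{C})\|^2. \] In particular one has $\frac{dV}{ds}\geq0$, with equality only if $\mathcal{A}\mathbf{C}$ is a multiple of $\mathbf{T}$.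
   Context: For a nonzero vector $\mathbf{u}$, $\mathfrak{p}_{\mathbf{u}}(\mathbf{w})=\mathbf{w}-\frac{\langle\mathbf{w},\mathbf{u}\rangle}{\|\mathbf{u}\|^2}\mathbf{u}$. The soliton flow is the flow on $\mathbb{R}^n\times\mathbb{S}^{n-1}$ of the system $\mathbf{C}_s=\mathbf{T}$, $\mathbf{T}_s=\mathfrak{p}_{\mathbf{T}}[(\alpha+\mathcal{A})\mathbf{C}+\mathbf{v}]$, where $\alpha$ stands for $\alpha$ times the identity. *)

(* Defs.v *)
From HB Require Import structures.
From mathcomp Require Import all_boot all_order all_algebra.
From mathcomp Require Import all_classical all_reals all_analysis.

Set Implicit Arguments.
Unset Strict Implicit.
Unset Printing Implicit Defensive.

Import Order.TTheory GRing.Theory Num.Theory.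
Import numFieldNormedType.Exports.

Local Open Scope classical_set_scope.
Local Open Scope ring_scope.

(* The norm that MathComp-Analysis puts on matrices is the sup norm, hence the
   separate Euclidean structure; the topologies, and so the derivatives of
   vector-valued functions, are the same. *)
Definition dotv (R : realType) (n : nat) (u w : 'cV[R]_n) : R :=
  \sum_(i < n) u i ord0 * w i ord0.

Definition enorm (R : realType) (n : nat) (u : 'cV[R]_n) : R :=
  Num.sqrt (dotv u u).

(* Meaningful for u != 0 only; proj_orth 0 is the identity since 0^-1 = 0. *)
Definition proj_orth (R : realType) (n : nat) (u w : 'cV[R]_n) : 'cV[R]_n :=
  w - (dotv w u / enorm u ^+ 2) *: u.

(* J is an open interval, bounded or not (J = setT is allowed). *)
Definition soliton_solution (R : realType) (n : nat) (alpha : R)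
    (A : 'M[R]_n) (v : 'cV[R]_n) (J : set R) (C T : R -> 'cV[R]_n) : Prop :=
  [/\ open J,
      is_interval J &
      forall s, J s ->
        [/\ enorm (T s) = 1,
            is_derive s (1 : R) C (T s) &
            is_derive s (1 : R) T
              (proj_orth (T s) ((alpha%:M + A) *m C s + v))]].

Definition soliton_weight (R : realType) (n : nat) (alpha : R)
    (v : 'cV[R]_n) (C : 'cV[R]_n) : R :=
  expR (alpha / 2 * enorm C ^+ 2 + dotv v C).

Definition soliton_V (R : realType) (n : nat) (alpha : R)
    (A : 'M[R]_n) (v : 'cV[R]_n) (C T : 'cV[R]_n) : R :=
  soliton_weight alpha v C * dotv T (A *m C).

(* Main.v *)
Require Import Defs.
From HB Require Import structures.
From mathcomp Require Import all_boot all_order all_algebra.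
From mathcomp Require Import all_classical all_reals all_analysis.
From mathcomp Require Import ring.

(** Write [AC] for [A *m C].  The weight [exp (alpha / 2 * |C|^2 + <v, C>)] has
    logarithmic derivative [alpha * <C, T> + <v, T>] along the flow.  As [A] is
    antisymmetric, [<T, A T> = 0], so the derivative of [<T, AC>] is [<T', AC>]
    where [T'] is the projection orthogonal to [T] of [alpha C + AC + v].
    Antisymmetry also gives [<C, AC> = 0] and, with [A v = 0], [<v, AC> = 0];
    since [|T| = 1], this leaves
      [<T', AC> = |AC|^2 - (alpha * <C, T> + <AC, T> + <v, T>) * <T, AC>].
    In the derivative of the product the terms in [alpha] and [v] cancel, and
    what remains, [|AC|^2 - <AC, T>^2], is the squared norm of the projection
    of [AC] by Pythagoras ([enorm_proj_orth]).  It vanishes only if the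
    projection does, that is, if [AC = <AC, T> T]. *)

Set Implicit Arguments.
Unset Strict Implicit.
Unset Printing Implicit Defensive.

Import Order.TTheory GRing.Theory Num.Theory.
Import numFieldNormedType.Exports.

Local Open Scope classical_set_scope.
Local Open Scope ring_scope.

Section EuclideanStructure.
Variables (R : realType) (n : nat).
Implicit Types (u w z : 'cV[R]_n) (A : 'M[R]_n) (a : R).

Lemma dotv_mulmx u w : dotv u w = (u^T *m w) ord0 ord0.
Proof. by rewrite mxE; apply: eq_bigr => i _; rewrite mxE. Qed.

Lemma dotvC u w : dotv u w = dotv w u.
Proof. by apply: eq_bigr => i _; rewrite mulrC. Qed.

Lemma dotvDl u w z : dotv (u + w) z = dotv u z + dotv w z.
Proof. by rewrite !dotv_mulmx linearD mulmxDl mxE. Qed.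

Lemma dotvZl a u w : dotv (a *: u) w = a * dotv u w.
Proof. by rewrite !dotv_mulmx linearZ -scalemxAl mxE. Qed.

Lemma dot0v u : dotv 0 u = 0.
Proof. by rewrite dotv_mulmx trmx0 mul0mx mxE. Qed.

Lemma dotvBl u w z : dotv (u - w) z = dotv u z - dotv w z.
Proof. by rewrite -scaleN1r dotvDl dotvZl mulN1r. Qed.

Lemma dotv_adjoint A u w : dotv u (A *m w) = dotv (A^T *m u) w.
Proof. by rewrite !dotv_mulmx trmx_mul trmxK mulmxA. Qed.

Lemma dotv_antisym A u w : A^T = - A -> dotv u (A *m w) = - dotv (A *m u) w.
Proof.
by move=> AN; rewrite dotv_adjoint AN mulNmx -scaleN1r dotvZl mulN1r.
Qed.

Lemma dotv_antisym_diag A u : A^T = - A -> dotv u (A *m u) = 0.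
Proof.
move=> AN; have := dotv_antisym u u AN; rewrite [dotv (A *m u) u]dotvC.
by move/eqP; rewrite -addr_eq0 -mulr2n mulrn_eq0 /= => /eqP.
Qed.

Lemma dotv_ge0 u : 0 <= dotv u u.
Proof. by apply: sumr_ge0 => i _; rewrite -expr2 sqr_ge0. Qed.

Lemma dotv_eq0 u : dotv u u = 0 -> u = 0.
Proof.
move=> /eqP; rewrite psumr_eq0 => [/allP u0|i _]; last by rewrite -expr2 sqr_ge0.
apply/colP => i; rewrite mxE.
by have := u0 i (mem_index_enum i); rewrite /= mulf_eq0 orbb => /eqP.
Qed.

Lemma sqr_enorm u : enorm u ^+ 2 = dotv u u.
Proof. by rewrite sqr_sqrtr // dotv_ge0. Qed.

Lemma dotv_proj_orth u w z : enorm u = 1 ->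
  dotv (proj_orth u w) z = dotv w z - dotv w u * dotv u z.
Proof. by move=> u1; rewrite dotvBl dotvZl u1 expr1n divr1. Qed.

Lemma enorm_proj_orth u w : enorm u = 1 ->
  enorm (proj_orth u w) ^+ 2 = dotv w w - dotv w u ^+ 2.
Proof.
move=> u1; have uu : dotv u u = 1 by rewrite -sqr_enorm u1 expr1n.
rewrite sqr_enorm dotv_proj_orth // [dotv w _]dotvC [dotv u _]dotvC.
by rewrite !dotv_proj_orth // uu [dotv u w]dotvC; ring.
Qed.

End EuclideanStructure.

Section Curves.
Variables (R : realType) (n : nat).
Implicit Types (f g : R -> 'cV[R]_n) (df dg : 'cV[R]_n) (s : R).

Lemma is_derive_coord f df s (i : 'I_n) :
  is_derive s (1 : R) f df ->
  is_derive s (1 : R) (fun t => f t i ord0) (df i ord0).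
Proof.
move=> [fd <-]; have /derivable_mxP fdi := fd.
by split; [exact: fdi | rewrite derive_mx // mxE].
Qed.

Lemma is_derive_dotv f g df dg s :
  is_derive s (1 : R) f df -> is_derive s (1 : R) g dg ->
  is_derive s (1 : R) (fun t => dotv (f t) (g t))
    (dotv df (g s) + dotv (f s) dg).
Proof.
move=> fd gd.
have -> : (fun t => dotv (f t) (g t)) =
    \sum_(i < n) (fun t => f t i ord0) * (fun t => g t i ord0).
  by apply/funext => t; rewrite fct_sumE.
rewrite /dotv -big_split /=.
have fdi i := is_derive_coord i fd; have gdi i := is_derive_coord i gd.
apply: is_derive_sum => i; apply: is_derive_eq.
by rewrite /= /GRing.scale /=; ring.
Qed.

Lemma is_derive_mulmx (A : 'M[R]_n) f df s :
  is_derive s (1 : R) f df ->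
  is_derive s (1 : R) (fun t => A *m f t) (A *m df).
Proof.
move=> fd; have fdi i := is_derive_coord i fd.
have Afd i : is_derive s (1 : R) (fun t => (A *m f t) i ord0) ((A *m df) i ord0).
  have -> : (fun t => (A *m f t) i ord0) =
      \sum_(j < n) A i j *: (fun t => f t j ord0).
    by apply/funext => t; rewrite fct_sumE mxE.
  by rewrite mxE; apply: is_derive_sum => j; apply: is_derive_eq.
have Ad : derivable (fun t => A *m f t) s 1.
  by apply/derivable_mxP => i j; rewrite ord1; case: (Afd i).
split=> //; rewrite derive_mx //.
by apply/colP => i; rewrite mxE; case: (Afd i).
Qed.

(** The logarithmic derivative of the weight along a curve with velocity
    [df]. *)
Lemma is_derive_soliton_weight alpha (v : 'cV[R]_n) f df s :
  is_derive s (1 : R) f df ->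
  is_derive s (1 : R) (fun t => soliton_weight alpha v (f t))
    (soliton_weight alpha v (f s) * (alpha * dotv (f s) df + dotv v df)).
Proof.
move=> fd; rewrite /soliton_weight.
have ffd := is_derive_dotv fd fd.
have vfd : is_derive s (1 : R) (fun t => dotv v (f t)) (dotv v df).
  have vd := is_derive_dotv (is_derive_cst v s 1) fd.
  by apply: is_derive_eq vd _; rewrite dot0v add0r.
pose h := (alpha / 2) *: (fun t => dotv (f t) (f t)) + (fun t => dotv v (f t)).
have -> : (fun t => expR (alpha / 2 * enorm (f t) ^+ 2 + dotv v (f t))) =
    expR \o h.
  by apply/funext => t /=; rewrite sqr_enorm.
have hd : is_derive s (1 : R) h (alpha * dotv (f s) df + dotv v df).
  apply: is_derive_eq; rewrite [dotv df _]dotvC /GRing.scale /=.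
  by field.
by apply: is_derive_eq; rewrite /h /= sqr_enorm.
Qed.

End Curves.

Theorem lemma8p1 (R : realType) (n : nat) (alpha : R)
    (A : 'M[R]_n) (v : 'cV[R]_n)
    (A_neq0 : A != 0) (A_antisym : A^T = - A) (Av0 : A *m v = 0)
    (J : set R) (C T : R -> 'cV[R]_n)
    (CT_sol : soliton_solution alpha A v J C T) (s : R) (Js : J s) :
  let V := fun t : R => soliton_V alpha A v (C t) (T t) in
  [/\ is_derive s (1 : R) V
        (soliton_weight alpha v (C s)
           * enorm (proj_orth (T s) (A *m C s)) ^+ 2),
      0 <= derive1 V s &
      derive1 V s = 0 -> exists k : R, A *m C s = k *: T s].
Proof.
move=> V; case: CT_sol => _ _ /(_ s Js) [T1 Cd Td].
have dV : is_derive s (1 : R) V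
    (soliton_weight alpha v (C s) * enorm (proj_orth (T s) (A *m C s)) ^+ 2).
  have Wd := is_derive_soliton_weight alpha v Cd.
  have TACd := is_derive_dotv Td (is_derive_mulmx A Cd).
  rewrite (_ : V = (fun t => soliton_weight alpha v (C t)) *
                   (fun t => dotv (T t) (A *m C t))) //.
  apply: is_derive_eq.
  (* The three vanishing pairings: <T, A T>, <C, A C> and <v, A C>. *)
  rewrite (dotv_antisym_diag (T s) A_antisym) dotv_proj_orth //.
  rewrite mulmxDl mul_scalar_mx !dotvDl !dotvZl (dotv_antisym_diag _ A_antisym).
  have -> : dotv v (A *m C s) = 0.
    by rewrite dotv_antisym // Av0 dot0v oppr0.
  rewrite enorm_proj_orth // [dotv (T s) _]dotvC /GRing.scale /=.
  by ring.
have V'E : derive1 V s =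
    soliton_weight alpha v (C s) * enorm (proj_orth (T s) (A *m C s)) ^+ 2.
  by rewrite derive1E; case: dV.
split=> //; first by rewrite V'E mulr_ge0 ?expR_ge0 ?sqr_ge0.
move=> /eqP; rewrite V'E mulf_eq0 gt_eqF ?expR_gt0 //= sqr_enorm => /eqP.
move=> /dotv_eq0 /eqP; rewrite subr_eq0 => /eqP ACE.
by exists (dotv (A *m C s) (T s) / enorm (T s) ^+ 2).
Qed.
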